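(* Let $k\in\mathbb{N}$ and let $R\subset\mathbb{N}$ be a set of strong $k$-recurrence. Then for any $A\subset\mathbb{N}$ with $\mathsf{d}^*(A)>0$ there exist infinite sets $B\subset R$ and $C\subset\mathbb{N}$ such that $\bigcup_{\ell=0}^k\{\ell b+c: b\in B,\ c\in C,\ b<c\}\subset A$.
   Context: $\mathsf{d}^*(A)=\limsup_{N-M\to\infty}\frac{|A\cap\{M+1,\dots,N\}|}{N-M}$ is the upper Banach density. A measure preserving system $(X,\mathcal{B},\mu,T)$ is a probability space with a measurable measure-preserving map $T:X\to X$. A set $R\subset\mathbb{N}$ is a set of strong $k$-recurrence if for every measure preserving system $(X,\mathcal{B},\mu,T)$ and every $E\in\mathcal{B}$ with $\mu(E)>0$ one has $\limsup_{n\in R,\,n\to\infty}\mu(E\cap T^{-n}E\cap\cdots\cap T^{-kn}E)>0$. *)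

(* Defs.v *)
From mathcomp Require Import all_boot all_order all_algebra finmap.
From mathcomp Require Import all_classical all_reals all_analysis.

Set Implicit Arguments.
Unset Strict Implicit.
Unset Printing Implicit Defensive.

Import Order.TTheory GRing.Theory Num.Theory.

Local Open Scope classical_set_scope.
Local Open Scope ring_scope.

(* The convention is N = {1, 2, ...}; sets of natural numbers are represented
   as subsets of posnat in the type set nat. *)
Definition posnat : set nat := [set n | (0 < n)%N].

(* The filter "N - M --> +oo" on pairs (M, N), generated by the sets
   {(M, N) | N - M >= L}. *)
Definition length_infty : set_system (nat * nat) :=
  filter_from [set: nat] (fun L => [set MN | (MN.1 + L <= MN.2)%N]).

Definition upper_banach_density (K : realType) (A : set nat) : \bar K :=
  limf_esup (fun MN : nat * nat =>
      ((#|` fset_set (A `&` [set n | (MN.1 < n <= MN.2)%N])|)%:R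
        / (MN.2 - MN.1)%N%:R)%:E)
    length_infty.

Definition measure_preserving (K : realType) (d : measure_display)
    (X : measurableType d) (mu : probability X K) (T : X -> X) : Prop :=
  measurable_fun [set: X] T /\
  forall E : set X, measurable E -> mu (T @^-1` E) = mu E.

(* T^{-m} E is the preimage of E under the m-th iterate of T. The limsup along
   n in R is -oo, hence not positive, when R is finite. *)
Definition strong_recurrence (K : realType) (k : nat) (R : set nat) : Prop :=
  forall (d : measure_display) (X : measurableType d) (mu : probability X K)
         (T : X -> X) (E : set X),
    measure_preserving mu T -> measurable E -> (0 < mu E)%E ->
    (0 < limf_esup
           (fun n : nat =>
              mu (\bigcap_(i in [set i | (i <= k)%N])
                    (iter (i * n)%N T @^-1` E)))
           (within R \oo))%E.

(* Main.v *)
(* Averaging along longer and longer windows on which A has density bounded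
   below, and taking an ultrafilter limit, gives a shift-invariant finitely
   additive mean m on the subsets of N with m(A) > 0.  Pushing m forward along
   c |-> (1_A(c + j))_j yields a finitely additive, shift-invariant content on
   the cylinders of {0,1}^N, which by compactness is countably additive and so
   extends to a shift-invariant probability mu; E = {x | x 0 = 1} has
   mu(E) = m(A) > 0.  Strong recurrence makes the limsup, over n in R, of the
   sets E_n = E `&` T^-n E `&` ... `&` T^-kn E have positive measure, so it
   contains a point x of the support of mu: x (l n) = 1 for all l <= k and for
   infinitely many n in R, while every prefix of x occurs in 1_A at arbitrarily
   large positions c.  Choosing b_0 < c_0 < b_1 < c_1 < ... with b_i among these
   n and c_i the position of a prefix of x longer than k b_i gives B and C. *)
From HB Require Import structures.
Require Import Defs.
From mathcomp Require Import all_boot all_order all_algebra finmap.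
From mathcomp Require Import all_classical all_reals all_analysis.

Local Open Scope classical_set_scope.

Set Implicit Arguments.
Unset Strict Implicit.
Unset Printing Implicit Defensive.

Import Order.TTheory GRing.Theory Num.Theory.
Import numFieldNormedType.Exports.

(** * Extending a content on the cylinders of Cantor space to a probability *)

Section CylinderMeasure.
Local Open Scope ring_scope.

(** Cantor space gets two aliases: this one carries the algebra of cylinders, where contents live,
    and [cylinder_sigma] the sigma-algebra it generates. *)
Definition cylinder_space : Type := cantor_space.

Definition agree (n : nat) (x y : nat -> bool) : Prop :=
  forall i, (i < n)%N -> x i = y i.

(** By compactness these are exactly the clopen subsets of Cantor space. *)
Definition cylinder (C : set (nat -> bool)) : Prop :=
  exists n, forall x y, agree n x y -> C x -> C y.

Lemma agree_sym n x y : agree n x y -> agree n y x.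
Proof. by move=> xy i /xy. Qed.

Lemma agree_leq m n x y : (m <= n)%N -> agree n x y -> agree m x y.
Proof. by move=> mn xy i im; apply: xy; exact: leq_trans im mn. Qed.

Lemma cylinder0 : cylinder set0.
Proof. by exists 0%N. Qed.

Lemma cylinderC : setC_closed cylinder.
Proof.
move=> C [n Cn]; exists n => x y xy nCx Cy.
exact: nCx (Cn y x (agree_sym xy) Cy).
Qed.

Lemma cylinderU : setU_closed cylinder.
Proof.
move=> C D [m Cm] [n Dn]; exists (maxn m n) => x y xy [Cx|Dx].
  by left; apply: Cm Cx; exact: agree_leq (leq_maxl _ _) xy.
by right; apply: Dn Dx; exact: agree_leq (leq_maxr _ _) xy.
Qed.

HB.instance Definition _ := Pointed.on cylinder_space.

HB.instance Definition _ := @isAlgebraOfSets.Build default_measure_display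
  cylinder_space cylinder cylinder0 cylinderU cylinderC.

Definition cylinder_sigma : Type :=
  g_sigma_algebraType (@measurable _ cylinder_space).

HB.instance Definition _ := Measurable.on cylinder_sigma.

Lemma agree_nbhs n (x : cantor_space) : nbhs x (agree n x).
Proof.
elim: n => [|n IHn]; first by apply: filterS (@filterT _ _ _) => y _ i.
have xn : nbhs x [set y : cantor_space | y n = x n].
  exact: (@proj_continuous nat (fun=> bool) n x _ (discrete_set1 (x n))).
apply: filterS2 IHn xn => y xy yn i; rewrite ltnS leq_eqVlt => /orP[/eqP->//|].
exact: xy.
Qed.

Lemma cylinder_open (C : set cantor_space) : cylinder C -> open C.
Proof.
move=> [n Cn]; rewrite openE => x Cx.
by apply: filterS (agree_nbhs n x) => y xy; apply: Cn Cx.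
Qed.

Lemma cylinder_compact (C : set cantor_space) : cylinder C -> compact C.
Proof.
move=> cC; apply: (subclosed_compact _ cantor_space_compact) => //.
rewrite -[C]setCK; apply: open_closedC; apply: cylinder_open.
exact: cylinderC.
Qed.

Section Extension.
Variables (K : realType) (nu : set (nat -> bool) -> K).
Hypotheses (nu_ge0 : forall C, 0 <= nu C) (nuT : nu setT = 1)
  (nuU : forall C D, C `&` D = set0 -> nu (C `|` D) = nu C + nu D).

Definition cylinder_content (C : set cylinder_space) : \bar K := (nu C)%:E.

Let nu0 : nu set0 = 0.
Proof.
by apply: (addrI (nu set0)); rewrite -nuU ?setUid ?setI0// addr0.
Qed.

Let content_ge0 C : (0 <= cylinder_content C)%E.
Proof. by rewrite lee_fin. Qed.

Let content_semi_additive : measure_function.semi_additive cylinder_content.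
Proof.
apply/additive2P; first by rewrite /cylinder_content nu0.
by move=> C D _ _ CD; rewrite /cylinder_content nuU// EFinD.
Qed.

HB.instance Definition _ := isContent.Build _ cylinder_space K cylinder_content
  content_ge0 content_semi_additive.

(** A cylinder is compact and the sets covering it are open, so a finite subcover reduces the claim
    to finite subadditivity. *)
Let content_sigma_subadditive :
  measurable_subset_sigma_subadditive cylinder_content.
Proof.
move=> C F cF cC CF.
have := @cylinder_compact C cC; rewrite compact_cover.
move=> /(_ nat setT F (fun i _ => cylinder_open (cF i)))[//|D _ CD].
have Dlt i : i \in D -> (i < (\max_(j <- D) j).+1)%N.
  by move=> iD; rewrite ltnS; exact: leq_bigmax_seq.
set N := _.+1 in Dlt.
apply: (@le_trans _ _ (\sum_(i < N) cylinder_content (F i)))%E.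
  apply: content_subadditive => //= x /CD[i /= iD Fix].
  by rewrite -bigcup_mkord; exists i => //=; exact: Dlt.
rewrite -(big_mkord xpredT (fun i => cylinder_content (F i))).
exact: nneseries_lim_ge.
Qed.

HB.instance Definition _ := Content_SigmaSubAdditive_isMeasure.Build
  _ K cylinder_space cylinder_content content_sigma_subadditive.

Definition cylinder_measure : set cylinder_sigma -> \bar K :=
  measure_extension cylinder_content.

HB.instance Definition _ := Measure.on cylinder_measure.

Lemma cylinder_measureE C : cylinder C -> cylinder_measure C = (nu C)%:E.
Proof. by move=> cC; exact: measurable_mu_extE. Qed.

Let cylinder_measureT : cylinder_measure setT = 1%E.
Proof.
by rewrite cylinder_measureE ?nuT// -setC0; apply/cylinderC/cylinder0.
Qed.

HB.instance Definition _ :=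
  Measure_isProbability.Build _ _ _ cylinder_measure cylinder_measureT.

Lemma cylinder_extension : exists mu : probability cylinder_sigma K,
  forall C, cylinder C -> mu C = (nu C)%:E.
Proof. by exists cylinder_measure => C cC; exact: cylinder_measureE. Qed.

End Extension.
End CylinderMeasure.

(** * Limits along filters and a shift-invariant mean *)

Section InvariantMean.
Local Open Scope ring_scope.

(** The limsup is an infimum of suprema over the members of the filter, so any [e] strictly below it
    is exceeded on each member. *)
Lemma limf_esup_gt0 (K : realType) (X : choiceType) (T : filteredType X)
    (f : T -> \bar K) (F : set_system T) :
  (0 < limf_esup f F)%E ->
  exists2 e : K, 0 < e & forall V, F V -> exists2 x, V x & (e%:E < f x)%E.
Proof.
move=> L0.
have [e e0 eL] : exists2 e : K, 0 < e & (e%:E < limf_esup f F)%E.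
  case: (limf_esup f F) L0 => [r| |] //=.
    rewrite lte_fin => r0; exists (r / 2); rewrite ?divr_gt0//.
    by rewrite lte_fin gtr_pMr ?invf_lt1 ?ltr1n.
  by move=> _; exists 1 => //; rewrite ltry.
exists e => // V FV.
have /ereal_sup_gt[_ [x Vx <-] ex] : (e%:E < ereal_sup (f @` V))%E.
  by apply: lt_le_trans eL _; apply: ereal_inf_lbound; exists V.
by exists x.
Qed.

(** Compactness gives a cluster point; an ultrafilter contains each set or its complement, which
    turns a cluster point into a limit. *)
Lemma ultra_cvg_compact (T : topologicalType) (I : Type) (U : set_system I)
    (f : I -> T) (A : set T) :
  UltraFilter U -> compact A -> (forall i, A (f i)) ->
  exists l : T, f @ U --> l.
Proof.
move=> UU cA Af.
have [l [_ lU]] : A `&` cluster (f @ U) !=set0.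
  by apply: cA; apply: (@filterE _ U _ (f @^-1` A)) => i; exact: Af.
exists l => B Bl.
have [//|UnB] := in_ultra_setVsetC (f @^-1` B) UU.
by have [x []] := lU (~` B) B UnB Bl.
Qed.

Section Freq.
Variable K : realType.

(** The ratio in [upper_banach_density], with the cardinality as a sum of indicators so that it can
    be split and telescoped. *)
Definition freq (S : set nat) (MN : nat * nat) : K :=
  (\sum_(MN.1.+1 <= i < MN.2.+1) (`[< S i >])%:R) / (MN.2 - MN.1)%N%:R.

Lemma card_window (S : set nat) (M N : nat) :
  #|` fset_set (S `&` [set n | (M < n <= N)%N])|
    = (\sum_(M.+1 <= i < N.+1) `[< S i >])%N.
Proof.
pose s := [seq i <- index_iota M.+1 N.+1 | `[< S i >]].
have -> : S `&` [set n | (M < n <= N)%N] = [set` seq_fset tt s].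
  apply/seteqP; split=> n;
      rewrite /setI /mkset seq_fsetE mem_filter mem_index_iota ltnS.
    by move=> [Sn ->]; rewrite andbT; apply/asboolP.
  by move=> /andP[/asboolP].
rewrite set_fsetK size_seq_fset undup_id ?filter_uniq ?iota_uniq//.
rewrite size_filter -sum1_count big_mkcond.
by apply: eq_bigr => i _; case: asbool.
Qed.

Lemma freq_ge0 S MN : 0 <= freq S MN.
Proof. by rewrite divr_ge0// sumr_ge0. Qed.

Lemma freq_le1 S MN : freq S MN <= 1.
Proof.
rewrite /freq; have [NM|MN0] := leqP MN.2 MN.1.
  (* An empty window has truncated length 0, and [0^-1 = 0] makes its frequency 0. *)
  by rewrite (eqP (_ : MN.2 - MN.1 == 0)%N) ?subn_eq0// invr0 mulr0.
rewrite ler_pdivrMr ?ltr0n ?subn_gt0// mul1r -subSS -sumr_const_nat.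
by apply: ler_sum => i _; rewrite lern1 leq_b1.
Qed.

Lemma freqT MN : (MN.1 < MN.2)%N -> freq setT MN = 1.
Proof.
move=> MN0; rewrite /freq (eq_bigr (fun=> 1)) => [|i _]; last first.
  by rewrite asboolT.
by rewrite sumr_const_nat subSS divff// pnatr_eq0 -lt0n subn_gt0.
Qed.

Lemma freqU S S' MN : S `&` S' = set0 ->
  freq (S `|` S') MN = freq S MN + freq S' MN.
Proof.
move=> SS'; rewrite /freq -mulrDl -big_split/=; congr (_ / _).
apply: eq_bigr => i _; rewrite -natrD; congr _%:R.
rewrite asbool_or; case: asboolP => Si; case: asboolP => S'i //=.
by have : set0 i by rewrite -SS'.
Qed.

(** The numerators differ by a telescoping sum, leaving two endpoint indicators whose difference is
    at most 1 in absolute value. *)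
Lemma freq_shift S n MN : (MN.1 + n.+1 <= MN.2)%N ->
  `|freq (succn @^-1` S) MN - freq S MN| <= n.+1%:R^-1.
Proof.
move=> MNn.
have MN0 : (MN.1 < MN.2)%N by apply: leq_trans MNn; rewrite addnS ltnS leq_addr.
rewrite /freq -mulrBl -sumrB.
rewrite (telescope_sumr (fun i => `[< S i >]%:R)) 1?ltnW ?ltnS//.
rewrite normrM [X in _ * X]ger0_norm ?invr_ge0// -[leRHS]mul1r.
rewrite ler_pM ?invr_ge0//.
  by do 2 case: asbool; rewrite /= ?subrr ?subr0 ?sub0r ?normrN ?normr0 ?normr1.
rewrite lef_pV2 ?posrE ?ltr0n ?subn_gt0// ler_nat leq_subRL//; exact: ltnW.
Qed.

Lemma invariant_mean (A : set nat) : (0 < upper_banach_density K A)%E ->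
  exists m : set nat -> K,
    [/\ forall S, 0 <= m S, m setT = 1,
        forall S S', S `&` S' = set0 -> m (S `|` S') = m S + m S',
        forall S, m (succn @^-1` S) = m S & 0 < m A].
Proof.
move=> /limf_esup_gt0[e e0 eA].
have /choice[p pP] : forall n : nat, exists MN : nat * nat,
    (MN.1 + n.+1 <= MN.2)%N /\ e < freq A MN.
  move=> n; have [|MN MNn] := eA [set MN | (MN.1 + n.+1 <= MN.2)%N].
    by exists n.+1.
  by rewrite card_window lte_fin natr_sum => eMN; exists MN.
(* One ultrafilter refining [\oo] yields limits for all [S] at once, so additivity passes to the
   limit; shift invariance follows from the bound [1/(n+1)]. *)
have [U [UU Uoo]] := @ultraFilterLemma _ (\oo : set_system nat) _.
have /choice[m mP] : forall S, exists l : K, (fun n => freq S (p n)) @ U --> l.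
  move=> S; apply: (ultra_cvg_compact UU (@segment_compact K 0 1)) => n /=.
  by rewrite in_itv/= freq_ge0 freq_le1.
have cvgU S l : (fun n => freq S (p n)) @ U --> l -> m S = l.
  exact: (cvg_unique (@Rhausdorff K) (mP S)).
have limE S : m S = lim ((fun n => freq S (p n)) @ U).
  by apply/esym/cvg_lim => //; exact: mP.
have cvS S : cvg ((fun n => freq S (p n)) @ U).
  by apply/cvg_ex; exists (m S); exact: mP.
exists m; split.
- move=> S; rewrite limE; apply: limr_ge => //.
  by apply: nearW => n; exact: freq_ge0.
- apply: cvgU; rewrite [X in X @ _ --> _](_ : _ = cst 1); first exact: cvg_cst.
  apply/funext => n; rewrite freqT//.
  by rewrite (leq_trans _ (pP n).1)// addnS ltnS leq_addr.
- move=> S S' SS'; apply: cvgU.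
  under eq_fun do rewrite freqU//.
  exact: (cvgD (mP S) (mP S')).
- move=> S; apply/eqP; rewrite -subr_eq0; apply/eqP.
  apply: (cvg_unique (@Rhausdorff K) (cvgB (mP (succn @^-1` S)) (mP S))).
  apply: cvg_trans (cvg_app _ Uoo) _; apply/cvgr0Pnorm_le.
  move=> d d0; have : harmonic @ \oo --> (0 : K) by exact: cvg_harmonic.
  move=> /cvgr0Pnorm_le/(_ _ d0); apply: filterS => n /=.
  apply: le_trans; rewrite [leRHS]ger0_norm ?invr_ge0//.
  exact: freq_shift (pP n).1.
- apply: lt_le_trans e0 _; rewrite limE; apply: limr_ge => //.
  by apply: nearW => n; exact: ltW (pP n).2.
Qed.

End Freq.
End InvariantMean.

(** * The shift system attached to the mean, and a recurrent point in it *)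

Section Correspondence.
Local Open Scope ring_scope.

Definition shift (x : cylinder_sigma) : cylinder_sigma := fun j => x j.+1.

(** The [c]-th iterate of [shift] at the indicator of [A]. *)
Definition orbit_point (A : set nat) (c : nat) : nat -> bool :=
  fun j => `[< A (c + j)%N >].

Lemma iter_shift n (x : cylinder_sigma) j : iter n shift x j = x (j + n)%N.
Proof. by elim: n j => [|n IHn] j; rewrite ?addn0//= /shift IHn addSnnS. Qed.

Lemma orbit_pointS A c : orbit_point A c.+1 = shift (orbit_point A c).
Proof. by apply/funext => j; rewrite /orbit_point /shift addSnnS. Qed.

Lemma cylinder_shift C : cylinder C -> cylinder (shift @^-1` C).
Proof. by move=> [n Cn]; exists n.+1 => x y xy; apply: Cn => i ?; exact: xy. Qed.

Lemma cylinder_measurable (C : set cylinder_sigma) : cylinder C -> measurable C.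
Proof. by move=> cC; apply: (@sub_sigma_algebra _ setT cylinder C cC). Qed.

Lemma measurable_shift : measurable_fun setT shift.
Proof.
apply: (@measurability _ _ _ cylinder_sigma _ _ cylinder) => // _ [C cC <-].
by rewrite setTI; apply: cylinder_measurable; exact: cylinder_shift.
Qed.

(** Cylinders are stable under intersection and generate, so [mu] and its pushforward agree
    everywhere once they agree on cylinders. *)
Lemma shift_measure_preserving (K : realType)
    (mu : probability cylinder_sigma K) :
  (forall C, cylinder C -> mu (shift @^-1` C) = mu C) ->
  measure_preserving mu shift.
Proof.
move=> muC; split=> [|E mE]; first exact: measurable_shift.
apply: (@measure_unique _ K cylinder_sigma cylinder (fun=> setT) erefl _ _ _
  (measure_function_pushforward__canonical__measure_function_Measure
     mu measurable_shift) mu) => //.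
- exact: (@measurableI _ cylinder_space).
- by move=> _; rewrite -setC0; apply/cylinderC/cylinder0.
- by rewrite bigcup_const.
- by move=> _; rewrite /= /pushforward preimage_setT probability_setT ltry.
Qed.

Definition word (s : seq bool) : set (nat -> bool) :=
  [set x | forall i, (i < size s)%N -> x i = nth false s i].

Lemma cylinder_word s : cylinder (word s).
Proof. by exists (size s) => x y xy sx i si; rewrite -xy// sx. Qed.

(* There are only countably many cylinders, so the union of the null ones is
   null. *)
Lemma exists_in_support (K : realType) (mu : probability cylinder_sigma K)
    (D : set cylinder_sigma) :
  measurable D -> (0 < mu D)%E ->
  exists2 x, D x & forall s, word s x -> mu (word s) != 0%E.
Proof.
move=> mD D0.
pose w (n : nat) : set cylinder_sigma := word (odflt [::] (choice.unpickle n)).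
pose Z n := if mu (w n) == 0%E then w n else set0.
have Z0 : mu.-negligible (\bigcup_n Z n).
  apply: negligible_bigcup => n; rewrite /Z; case: ifPn => [/eqP mu0|_].
    exists (w n); split=> //; apply: cylinder_measurable.
    exact: cylinder_word.
  exact: negligible_set0.
have /nonsubset[x [Dx nZx]] : ~ (D `<=` \bigcup_n Z n).
  move=> /negligibleS/(_ Z0)/(measure_negligible mD) D00.
  by rewrite D00 ltxx in D0.
exists x => // s sx; apply/negP => mu0; apply: nZx.
by exists (choice.pickle s) => //; rewrite /Z /w choice.pickleK /= mu0.
Qed.

(** Tail unions decrease to the limsup set and each has measure at least [e]; continuity from above
    concludes. *)
Lemma lim_sup_set_ge d (T : measurableType d) (K : realType)
    (mu : probability T K) (F : (set T)^nat) (e : \bar K) :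
  (forall n, measurable (F n)) ->
  (forall N, exists2 n, (N <= n)%N & (e <= mu (F n))%E) ->
  (e <= mu (lim_sup_set F))%E.
Proof.
move=> mF eF.
have mUF N : measurable (\bigcup_(n in [set n | (N <= n)%N]) F n).
  by apply: bigcup_measurable => *.
have cvgF := lim_sup_set_cvg mu F mF
  (le_lt_trans (probability_le1 mu (mUF 0%N)) (ltry 1)).
rewrite -(cvg_lim _ cvgF)//; apply: lime_ge.
  by apply/cvg_ex; eexists; exact: cvgF.
apply: nearW => N; have [n Nn en] := eF N.
apply: le_trans en (le_measure _ _ _ _); rewrite ?inE//.
by move=> x Fx; exists n.
Qed.

Section MeanFacts.
Variables (K : realType) (m : set nat -> K).
Hypotheses (mU : forall S S', S `&` S' = set0 -> m (S `|` S') = m S + m S')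
  (mS : forall S, m (succn @^-1` S) = m S).

(** Translating by [N.+1] keeps the mean, but would empty a set with no element beyond [N]. *)
Lemma mean_unbounded S N : m S != 0 -> exists2 c, (N < c)%N & S c.
Proof.
move=> mS0; apply: contrapT => nS; move/eqP: mS0; apply.
have m0 : m set0 = 0.
  by apply: (addrI (m set0)); rewrite -mU ?setUid ?setI0// addr0.
have mSn n : m ((fun c => (c + n)%N) @^-1` S) = m S.
  elim: n => [|n IHn].
    by congr m; apply/funext => c; rewrite /preimage /= addn0.
  rewrite -IHn -[RHS]mS; congr m.
  by apply/funext => c; rewrite /preimage /= addSnnS.
rewrite -(mSn N.+1) -m0; congr m; rewrite -subset0 => c /= Sc.
by apply: nS; exists (c + N.+1)%N => //; rewrite addnS ltnS leq_addl.
Qed.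

End MeanFacts.

Lemma recurrent_point (K : realType) (k : nat) (R A : set nat) :
  strong_recurrence K k R -> (0 < upper_banach_density K A)%E ->
  exists x : nat -> bool,
    (forall N, exists2 n, (N <= n)%N &
       R n /\ forall l, (l <= k)%N -> x (l * n)%N) /\
    (forall n N, exists2 c, (N < c)%N &
       forall j, (j < n)%N -> x j = `[< A (c + j)%N >]).
Proof.
move=> recR /invariant_mean[m [m_ge0 m1 mU mS mA]].
pose nu (C : set (nat -> bool)) : K := m (orbit_point A @^-1` C).
have [||C D CD|mu muE] := @cylinder_extension K nu.
- by move=> C; exact: m_ge0.
- by rewrite /nu preimage_setT.
- by rewrite /nu preimage_setU mU// -preimage_setI CD preimage_set0.
have Tmu : measure_preserving mu shift.
  apply: shift_measure_preserving => C cC.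
  rewrite !muE//; last exact: cylinder_shift.
  rewrite /nu -[in RHS]mS; congr (m _)%:E; apply/funext => c.
  by rewrite /preimage /= -orbit_pointS.
pose E : set cylinder_sigma := [set x | x 0%N].
have cE : cylinder E by exists 1%N => x y xy; rewrite /E /= xy.
have mE : measurable E by exact: cylinder_measurable.
have E0 : (0 < mu E)%E.
  rewrite muE// lte_fin /nu (_ : _ @^-1` _ = A)//; apply/funext => c.
  by rewrite /E /preimage /orbit_point /= addn0 asboolE.
have [e e0 He] := limf_esup_gt0 (recR _ _ mu shift E Tmu mE E0).
(* Putting [R n] inside makes [F n] empty off [R], so [lim_sup_set F] only sees return times in
   [R]. *)
pose F n : set cylinder_sigma :=
  [set x | R n /\ forall l, (l <= k)%N -> x (l * n)%N].
have FE n : R n ->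
    \bigcap_(i in [set i | (i <= k)%N]) (iter (i * n) shift @^-1` E) = F n.
  move=> Rn; apply/seteqP; split=> [x Ex|x [_ Fx] l lk].
    by split=> // l lk; have := Ex l lk; rewrite /E /preimage /= iter_shift.
  by rewrite /E /preimage /= iter_shift; exact: Fx.
have mF n : measurable (F n).
  apply: cylinder_measurable; exists (k * n).+1 => x y xy [Rn Fx].
  split=> // l lk.
  by rewrite -xy ?Fx// ltnS leq_mul2r lk orbT.
have [x Fx wx] : exists2 x, lim_sup_set F x &
    forall s, word s x -> mu (word s) != 0%E.
  apply: exists_in_support.
    by apply: bigcapT_measurable => N; apply: bigcup_measurable => *.
  apply: lt_le_trans (lim_sup_set_ge mF _ : (e%:E <= _)%E).
    by rewrite lte_fin.
  move=> N; have [|n [Rn Nn] en] := He [set n | R n /\ (N <= n)%N].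
    by exists N => // n /= Nn Rn.
  by exists n => //; rewrite -FE//; exact: ltW.
exists x; split=> [N|n N].
  by have [n /= Nn [Rn Fn]] := Fx N I; exists n.
(* The measure of the length-[n] prefix of [x] is the mean of the set of [c] at which [A] shows that
   prefix; being nonzero, it forces arbitrarily large [c]. *)
have := wx (mkseq x n); rewrite muE; last exact: cylinder_word.
rewrite eqe => /(_ _)/(mean_unbounded mU mS N)[|c Nc xc].
  by move=> i; rewrite size_mkseq => ?; rewrite nth_mkseq.
exists c => // j jn; have := xc j; rewrite size_mkseq nth_mkseq// => /(_ jn).
by [].
Qed.

End Correspondence.

(** * Interlaced choice of the two infinite sets *)

Lemma infinite_range_ltn (u : nat -> nat) :
  (forall i j, (i < j)%N -> (u i < u j)%N) -> infinite_set (range u).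
Proof.
move=> u_lt; have u_inj : {in setT &, injective u}.
  by move=> i j _ _ uij; case: (ltngtP i j) => // /u_lt; rewrite uij ltnn.
by rewrite (eq_finite_set (inj_card_eq u_inj)); exact: infinite_nat.
Qed.

Lemma interlaced_sequences (P : nat -> Prop) (Q : nat -> nat -> Prop) :
  (forall N, exists2 b, (N <= b)%N & P b) ->
  (forall b, exists2 c, (b < c)%N & Q b c) ->
  exists u v : nat -> nat, forall n,
    [/\ P (u n), Q (u n) (v n), (u n < v n)%N & (v n < u n.+1)%N].
Proof.
move=> exP exQ.
have /choice[f fP] : forall N, exists b, (N <= b)%N /\ P b.
  by move=> N; have [b] := exP N; exists b.
have /choice[g gP] : forall b, exists c, (b < c)%N /\ Q b c.
  by move=> b; have [c] := exQ b; exists c.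
(* The successor turns the weak bound [N <= b] into [v n < u n.+1]. *)
pose u := fix u n := if n is n'.+1 then f (g (u n')).+1 else f 0%N.
exists u, (g \o u) => n; split=> /=.
- by case: n => [|n] /=; exact: (fP _).2.
- exact: (gP _).2.
- exact: (gP _).1.
- exact: (fP _).1.
Qed.

Theorem theorem3p35 (K : realType) (k : nat) (hk : (0 < k)%N)
    (R : set nat) (hR : R `<=` posnat) (hrec : strong_recurrence K k R)
    (A : set nat) (hA : A `<=` posnat)
    (hdens : (0 < upper_banach_density K A)%E) :
  exists B C : set nat,
    [/\ B `<=` R, C `<=` posnat, infinite_set B, infinite_set C &
        \bigcup_(l in [set l | (l <= k)%N])
          [set n | exists b c : nat,
             [/\ B b, C c, (b < c)%N & n = (l * b + c)%N]] `<=` A].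
Proof.
have [x [xR xA]] := recurrent_point hrec hdens.
pose P n := R n /\ forall l, (l <= k)%N -> x (l * n)%N.
(* A prefix of length [k * b + 1] covers every position [l * b'] with [l <= k] and [b' <= b]. *)
pose Q b c := forall j, (j < (k * b).+1)%N -> x j = `[< A (c + j)%N >].
have [u [v uv]] := @interlaced_sequences P Q xR (fun b => xA (k * b).+1 b).
have u_lt i j : (i < j)%N -> (u i < u j)%N.
  apply: (homo_ltn (@ltn_trans)) => {}i.
  by have [_ _ + +] := uv i; exact: ltn_trans.
have v_lt i j : (i < j)%N -> (v i < v j)%N.
  apply: (homo_ltn (@ltn_trans)) => {}i.
  have [_ _ _ vu] := uv i; have [_ _ + _] := uv i.+1; exact: ltn_trans.
exists (range u), (range v); split.
- by move=> _ [i _ <-]; have [[]] := uv i.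
- by move=> _ [i _ <-]; have [_ _ ulv _] := uv i; exact: leq_ltn_trans ulv.
- exact: infinite_range_ltn.
- exact: infinite_range_ltn.
move=> _ [l lk [_ [_ [[i _ <-] [j _ <-] uivj ->]]]].
(* If [j < i], then [v j < u j.+1 <= u i], contradicting [u i < v j]. *)
have uij : (u i <= u j)%N.
  case: (leqP i j) => [|ji].
    by rewrite leq_eqVlt => /predU1P[->//|/u_lt/ltnW].
  have [_ _ _ vu] := uv j.
  have : (u j.+1 <= u i)%N.
    by move: ji; rewrite leq_eqVlt => /predU1P[->//|/u_lt/ltnW].
  by move=> /(leq_trans (ltn_trans uivj vu)); rewrite ltnn.
have [_ Qj _ _] := uv j; have [[_ Pi] _ _ _] := uv i.
(* Since [l * u i <= k * u j], membership of [v j + l * u i] in [A] is read off as [x (l * u i)],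
   which is true by the choice of [u i]. *)
rewrite addnC; apply/asboolP; rewrite -Qj ?Pi//.
by rewrite ltnS leq_mul.
Qed.
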